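(* Let $K$ be a complete discretely valued field with uniformizer $\pi$ and residue field of characteristic different from $2$, and let $D=\left(\frac{a,\pi}{K}\right)$ be a quaternion division algebra over $K$ with $a\in\mathcal{O}_K^*$, with $K$-basis $1,x,y,z$ where $x^2=a$, $y^2=\pi$, $z=xy=-yx$. Let $\sigma\in\{\tau,\tau_x,\tau_y\}$, $\epsilon\in\{1,-1\}$, and let $\delta,\alpha,\beta,\gamma\in\mathcal{O}_K$ be such that $u=\delta+\alpha x+\beta y+\gamma z$ satisfies $\sigma(u)=\epsilon u$ and $\nu_D(u)=\frac12$; let $h=\langle u\rangle$, a one-dimensional ramified $\epsilon$-hermitian form over $(D,\sigma)$. Then: (1) If $\sigma=\tau$, then necessarily $\epsilon=-1$, $h\cong\langle\beta y+\gamma z\rangle$, and $\beta+\gamma x$ is a unit (of the valuation ring) of the field $K(x)$. (2) If $\sigma=\tau_x$, then necessarily $\epsilon=1$, $h\cong\langle\beta y+\gamma z\rangle$, and $\beta+\gamma x$ is a unit of the field $K(x)$. (3) If $\sigma=\tau_y$ and $\epsilon=1$, then $h\cong\langle\gamma z\rangle$ and $\gamma\in\mathcal{O}_K^*$. (4) If $\sigma=\tau_y$ and $\epsilon=-1$, then $h\cong\langle\beta y\rangle$ and $\beta\in\mathcal{O}_K^*$.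
   Context: $\mathcal{O}_K$ is the valuation ring of the normalized valuation $\nu_K$ of $K$. $\nu_D(d)=\frac12\nu_K(\mathrm{Nrd}(d))$ for $d\in D\setminus\{0\}$ is the extension of $\nu_K$ to $D$. $\tau$ is the canonical (symplectic) involution of $D$: $\tau(x)=-x$, $\tau(y)=-y$, $\tau(z)=-z$. For $\lambda\in\{x,y\}$, $\tau_\lambda(d)=\lambda\tau(d)\lambda^{-1}$. For $u\in D^*$ with $\sigma(u)=\epsilon u$, $\langle u\rangle$ is the one-dimensional $\epsilon$-hermitian form $(d,d')\mapsto\sigma(d)ud'$ on $D$; thus $\langle u\rangle\cong\langle v\rangle$ iff $v=\sigma(t)ut$ for some $t\in D^*$. *)

(* Defs.v *)
From HB Require Import structures.
From mathcomp Require Import all_boot all_order all_algebra.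
From mathcomp Require Import ring_quotient.
From mathcomp Require Import ring.

Set Implicit Arguments.
Unset Strict Implicit.
Unset Printing Implicit Defensive.

Import Order.TTheory GRing.Theory Num.Theory.
Local Open Scope ring_scope.

(* Only the values of [nu] at nonzero elements are meaningful; nu 0 is a junk
   value standing for +oo, so every use of [nu] treats 0 separately. *)
Record discrete_valuation (K : fieldType) := DiscreteValuation {
  nu_fun :> K -> int;
  nuM : forall c d, c != 0 -> d != 0 -> nu_fun (c * d) = nu_fun c + nu_fun d;
  nuD : forall c d, c != 0 -> d != 0 -> c + d != 0 ->
    Num.min (nu_fun c) (nu_fun d) <= nu_fun (c + d);
  nu_surj : forall n : int, exists2 c, c != 0 & nu_fun c = n
}.

Section Valuation.
Variables (K : fieldType) (nu : discrete_valuation K).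

Definition nu_ge (n : int) : {pred K} := [pred c | (c == 0) || (n <= nu c)].

Definition nu_cauchy (s : nat -> K) : Prop := forall n : int,
  exists N, forall i j, (N <= i)%N -> (N <= j)%N -> s i - s j \in nu_ge n.

Definition nu_converges (s : nat -> K) (l : K) : Prop := forall n : int,
  exists N, forall i, (N <= i)%N -> s i - l \in nu_ge n.

Definition nu_complete : Prop :=
  forall s, nu_cauchy s -> exists l, nu_converges s l.

Definition val_ring : {pred K} := nu_ge 0.

Lemma nu1 : nu 1 = 0.
Proof.
have := nuM nu (oner_neq0 K) (oner_neq0 K).
by rewrite mulr1 => /eqP; rewrite -subr_eq subrr eq_sym => /eqP.
Qed.

Lemma nuN1 : nu (-1) = 0.
Proof.
have N0 : (-1 : K) != 0 by rewrite oppr_eq0 oner_eq0.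
have := nuM nu N0 N0; rewrite mulrNN mulr1 nu1 => /esym/eqP.
by rewrite -mulr2n mulrn_eq0 /= => /eqP.
Qed.

Lemma nuN c : nu (- c) = nu c.
Proof.
have [->|c0] := eqVneq c 0; first by rewrite oppr0.
by rewrite -mulN1r nuM ?nuN1 ?add0r // oppr_eq0 oner_eq0.
Qed.

Lemma nu_geB n : {in nu_ge n &, forall c d, c - d \in nu_ge n}.
Proof.
move=> c d; rewrite !inE => /orP[/eqP->|cn].
  by rewrite sub0r oppr_eq0 nuN.
move=> /orP[/eqP->|dn]; first by rewrite subr0 cn orbT.
have [//|cd0 /=] := eqVneq (c - d) 0.
have [-> |c0] := eqVneq c 0; first by rewrite sub0r nuN.
have [-> |d0] := eqVneq d 0; first by rewrite subr0.
have Nd0 : - d != 0 by rewrite oppr_eq0.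
by apply: le_trans (nuD nu c0 Nd0 cd0); rewrite nuN le_min cn dn.
Qed.

Lemma nu_geM m n c d :
  c \in nu_ge m -> d \in nu_ge n -> c * d \in nu_ge (m + n).
Proof.
rewrite !inE mulf_eq0; have [//|c0] := eqVneq c 0.
have [//|d0] := eqVneq d 0.
by rewrite /= nuM // => cm dn; apply: lerD.
Qed.

Fact val_ring_subring : subring_closed val_ring.
Proof.
split; first by rewrite inE nu1 lexx orbT.
  exact: nu_geB.
by move=> c d cO dO; rewrite /val_ring -[0]addr0 nu_geM.
Qed.
HB.instance Definition _ := GRing.isSubringClosed.Build K val_ring
  val_ring_subring.

Record val_ring_type := ValRing {
  val_ring_val :> K;
  val_ringP : val_ring_val \in val_ring
}.
HB.instance Definition _ := [isSub for val_ring_val].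
HB.instance Definition _ := [Choice of val_ring_type by <:].
HB.instance Definition _ :=
  [SubChoice_isSubComNzRing of val_ring_type by <:].

Definition max_ideal : {pred val_ring_type} :=
  [pred c | val c \in nu_ge 1].

Fact max_ideal_closed : idealr_closed max_ideal.
Proof.
split; rewrite ?inE ?raddf0 ?eqxx ?rmorph1 ?oner_eq0 ?nu1 //.
move=> c d e dm em; rewrite inE rmorphD rmorphM /=.
rewrite -[X in _ + X]opprK; apply: nu_geB.
  by rewrite -[1]add0r nu_geM // (valP c).
by move: em; rewrite !inE oppr_eq0 nuN.
Qed.
HB.instance Definition _ := isIdealr.Build val_ring_type max_ideal
  max_ideal_closed.

Definition residue_field := {ideal_quot max_ideal}.
HB.instance Definition _ := GRing.ComNzRing.on residue_field.

End Valuation.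

(* [quat a b] is the K-algebra (a, b / K): [Quat p q r s] is the element
   p + q x + r y + s z, where x ^+ 2 = a, y ^+ 2 = b and z = x y = - y x. *)
Record quat (K : fieldType) (a b : K) := Quat {
  qre : K; qix : K; qiy : K; qiz : K
}.
Arguments Quat {K a b}.

Section QuaternionAlgebra.
Variables (K : fieldType) (a b : K).
Local Notation D := (quat a b).

Definition quat_tuple (d : D) := (qre d, qix d, qiy d, qiz d).
Definition tuple_quat (t : K * K * K * K) : D :=
  let: (p, q, r, s) := t in Quat p q r s.
Fact quat_tupleK : cancel quat_tuple tuple_quat. Proof. by case. Qed.
HB.instance Definition _ := Choice.copy D (can_type quat_tupleK).

Definition qadd (d e : D) : D :=
  Quat (qre d + qre e) (qix d + qix e) (qiy d + qiy e) (qiz d + qiz e).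
Definition qopp (d : D) : D := Quat (- qre d) (- qix d) (- qiy d) (- qiz d).
Definition qscale (c : K) (d : D) : D :=
  Quat (c * qre d) (c * qix d) (c * qiy d) (c * qiz d).
Definition qmul (d e : D) : D :=
  let: Quat d0 d1 d2 d3 := d in
  let: Quat e0 e1 e2 e3 := e in
  Quat (d0 * e0 + a * (d1 * e1) + b * (d2 * e2) - a * b * (d3 * e3))
       (d0 * e1 + d1 * e0 - b * (d2 * e3) + b * (d3 * e2))
       (d0 * e2 + d2 * e0 + a * (d1 * e3) - a * (d3 * e1))
       (d0 * e3 + d3 * e0 + d1 * e2 - d2 * e1).

Fact qaddA : associative qadd.
Proof. by move=> [????] [????] [????]; congr Quat; rewrite /= addrA. Qed.
Fact qaddC : commutative qadd.
Proof. by move=> [????] [????]; congr Quat; rewrite /= addrC. Qed.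
Fact qadd0 : left_id (Quat 0 0 0 0) qadd.
Proof. by move=> [????]; congr Quat; rewrite /= add0r. Qed.
Fact qaddN : left_inverse (Quat 0 0 0 0) qopp qadd.
Proof. by move=> [????]; congr Quat; rewrite /= addNr. Qed.
HB.instance Definition _ := GRing.isZmodule.Build D qaddA qaddC qadd0 qaddN.

Fact qmulA : associative qmul.
Proof. by move=> [????] [????] [????] /=; congr Quat; ring. Qed.
Fact qmul1 : left_id (Quat 1 0 0 0) qmul.
Proof. by move=> [????] /=; congr Quat; ring. Qed.
Fact qmulr1 : right_id (Quat 1 0 0 0) qmul.
Proof. by move=> [????] /=; congr Quat; ring. Qed.
Fact qmulDl : left_distributive qmul +%R.
Proof. by move=> [????] [????] [????]; congr Quat => /=; ring. Qed.
Fact qmulDr : right_distributive qmul +%R.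
Proof. by move=> [????] [????] [????]; congr Quat => /=; ring. Qed.
Fact quat1_neq0 : Quat 1 0 0 0 != 0 :> D.
Proof. by apply/eqP => -[/eqP]; rewrite oner_eq0. Qed.
HB.instance Definition _ := GRing.Zmodule_isNzRing.Build D
  qmulA qmul1 qmulr1 qmulDl qmulDr quat1_neq0.

Fact qscaleA c d (e : D) : qscale c (qscale d e) = qscale (c * d) e.
Proof. by case: e => ????; congr Quat; rewrite /= mulrA. Qed.
Fact qscale1 : left_id 1 qscale.
Proof. by move=> [????]; congr Quat; rewrite /= mul1r. Qed.
Fact qscaleDr : right_distributive qscale +%R.
Proof. by move=> c [????] [????]; congr Quat; rewrite /= mulrDr. Qed.
Fact qscaleDl e : {morph qscale^~ e : c d / c + d}.
Proof. by move=> c d; congr Quat; rewrite /= mulrDl. Qed.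
HB.instance Definition _ := GRing.Zmodule_isLmodule.Build K D
  qscaleA qscale1 qscaleDr qscaleDl.

Fact qscaleAl (c : K) (d e : D) : c *: (d * e) = (c *: d) * e.
Proof. by case: d e => [????] [????]; congr Quat => /=; ring. Qed.
HB.instance Definition _ := GRing.Lmodule_isLalgebra.Build K D qscaleAl.

Fact qscaleAr (c : K) (d e : D) : c *: (d * e) = d * (c *: e).
Proof. by case: d e => [????] [????]; congr Quat => /=; ring. Qed.
HB.instance Definition _ := GRing.Lalgebra_isAlgebra.Build K D qscaleAr.

Definition quat_x : D := Quat 0 1 0 0.
Definition quat_y : D := Quat 0 0 1 0.
Definition quat_z : D := Quat 0 0 0 1.

Lemma quat_xx : quat_x ^+ 2 = a%:A.
Proof. by congr Quat => /=; ring. Qed.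
Lemma quat_yy : quat_y ^+ 2 = b%:A.
Proof. by congr Quat => /=; ring. Qed.
Lemma quat_xy : quat_x * quat_y = quat_z.
Proof. by congr Quat => /=; ring. Qed.
Lemma quat_yx : - (quat_y * quat_x) = quat_z.
Proof. by congr Quat => /=; ring. Qed.

Definition quat_conj (d : D) : D := Quat (qre d) (- qix d) (- qiy d) (- qiz d).

Definition nrd (d : D) : K :=
  qre d ^+ 2 - a * qix d ^+ 2 - b * qiy d ^+ 2 + a * b * qiz d ^+ 2.

Lemma quat_mul_conj d : d * quat_conj d = (nrd d)%:A.
Proof. by case: d => ????; congr Quat; rewrite /nrd /=; ring. Qed.
Lemma quat_conj_mul d : quat_conj d * d = (nrd d)%:A.
Proof. by case: d => ????; congr Quat; rewrite /nrd /=; ring. Qed.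

Lemma nrdM d e : nrd (d * e) = nrd d * nrd e.
Proof. by case: d e => [????] [????]; rewrite /nrd /=; ring. Qed.

Definition quat_unit : {pred D} := [pred d | nrd d != 0].
Definition quat_inv (d : D) : D :=
  if d \in quat_unit then (nrd d)^-1 *: quat_conj d else d.

Fact quat_mulVr : {in quat_unit, left_inverse 1 quat_inv *%R}.
Proof.
move=> d dU; rewrite /quat_inv dU -scalerAl quat_conj_mul scalerA.
by rewrite mulVf // scale1r.
Qed.
Fact quat_mulrV : {in quat_unit, right_inverse 1 quat_inv *%R}.
Proof.
move=> d dU; rewrite /quat_inv dU -scalerAr quat_mul_conj scalerA.
by rewrite mulVf // scale1r.
Qed.
Fact quat_unitP (d e : D) : e * d = 1 /\ d * e = 1 -> d \in quat_unit.
Proof.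
case=> _ /(congr1 nrd); rewrite nrdM => de1; rewrite inE; apply/eqP => d0.
move: de1; rewrite d0 mul0r /nrd /= !expr0n /= !mulr0 expr1n !subr0 addr0.
by move/eqP; rewrite eq_sym oner_eq0.
Qed.
Fact quat_inv_out : {in [predC quat_unit], quat_inv =1 id}.
Proof. by move=> d /negbTE; rewrite /quat_inv => ->. Qed.
HB.instance Definition _ := GRing.NzRing_hasMulInverse.Build D
  quat_mulVr quat_mulrV quat_unitP quat_inv_out.

Definition quat_conj_by (l d : D) : D := l * quat_conj d * l^-1.

End QuaternionAlgebra.
Arguments quat_x {K a b}.
Arguments quat_y {K a b}.
Arguments quat_z {K a b}.

Definition division_algebra (K : fieldType) (D : unitAlgType K) : Prop :=
  forall d : D, d != 0 -> d \is a GRing.unit.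

(* Meaningful for d != 0 only, like [nu]. *)
Definition nuD_quat (K : fieldType) (nu : discrete_valuation K) (a b : K)
  (d : quat a b) : rat := (nu (nrd d))%:~R / 2.

Section HermitianForms.
Variables (K : fieldType) (D : algType K) (sigma : D -> D) (eps : K).

(* Forms on D seen as a right D-module of rank one. *)
Definition eps_hermitian (h : D -> D -> D) : Prop :=
  [/\ forall d1 d2 e, h (d1 + d2) e = h d1 e + h d2 e,
      forall d e1 e2, h d (e1 + e2) = h d e1 + h d e2,
      forall d e c c', h (d * c) (e * c') = sigma c * h d e * c'
    & forall d e, sigma (h d e) = eps *: h e d].

Definition form1 (u : D) : D -> D -> D := fun d d' => sigma d * u * d'.

Definition isometric (h h' : D -> D -> D) : Prop :=
  [/\ eps_hermitian h, eps_hermitian h'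
    & exists f : D -> D,
      [/\ bijective f,
          forall d e, f (d + e) = f d + f e,
          forall d c, f (d * c) = f d * c
        & forall d e, h' (f d) (f e) = h d e]].

End HermitianForms.

(* The smallest K-subalgebra of D containing t and closed under inverses; when
   D is a division algebra it is the subfield K(t). *)
Definition adjoin (K : fieldType) (D : unitAlgType K) (t d : D) : Prop :=
  forall S : {pred D}, GRing.divalg_closed S -> t \in S -> d \in S.

(* The valuation of K(x) is the restriction of the one of D. *)
Definition val_ring_Kx (K : fieldType) (nu : discrete_valuation K) (a b : K)
  (d : quat a b) : Prop :=
  adjoin quat_x d /\ (d = 0 \/ 0 <= nuD_quat nu d).

Definition unit_of (R : nzRingType) (S : R -> Prop) (u : R) : Prop :=
  S u /\ exists v, [/\ S v, u * v = 1 & v * u = 1].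

(* Main.v *)
Require Import Defs.
From mathcomp Require Import all_boot all_order all_algebra.
From mathcomp Require Import ring_quotient generic_quotient ring zify.
Import GRing.Theory Num.Theory.
Local Open Scope quotient_scope.
Local Open Scope ring_scope.

(** Write u = (delta + alpha x) + w with w = beta y + gamma z.  The reduced
norm splits accordingly as nrd u = (delta^2 - a alpha^2) - pi B, where
B = beta^2 - a gamma^2 is also the norm of beta + gamma x.

Since D is a division algebra, a is not a square in K, and Hensel's lemma
([hensel_sqrt1]) shows that it is not even a square in the residue field:
hence a norm p^2 - a q^2 of integral elements lies in the maximal ideal only
when p and q do ([nonsquare_norm]).  As nu (nrd u) = 1, this applies to
delta^2 - a alpha^2, so that delta and alpha are in the maximal ideal, that norm
has valuation at least 2, and B must be a unit ([ramified_coef]).  This gives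
the claims on beta + gamma x.  Moreover beta and gamma cannot both vanish, while
for tau and tau_x the wrong sign of eps would force just that, because every
involution considered acts on each of the lines K, Kx, Ky, Kz by a sign.

As sigma acts by signs, sigma w = eps w.  Put g = w^-1 u.  If t is a square root
of g in K(g), then sigma(g) w = w g implies sigma(t) w = w t, and therefore
sigma(t) w t = w g = u, which is an isometry of <u> with <w>
([isometric_sqrt]).  Because w is the orthogonal projection of u for the norm
form, g has reduced trace 2; and nrd g = nrd u / nrd w is congruent to 1 modulo
the maximal ideal, hence is a square c^2 with c congruent to 1.  By
Cayley-Hamilton (g + c)^2 = (2 + 2 c) g ([quat_sqrt]), and 2 + 2 c is 4 times
an element congruent to 1, hence again a square, so that t is a scalar multiple
of g + c ([isometric_near]).  For sigma = tau_y the symmetry of u kills beta or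
gamma, and w is gamma z or beta y. *)

(** * Units of a discrete valuation ring and square roots *)

Section ValuationTheory.
Set Implicit Arguments.
Unset Strict Implicit.
Variables (K : fieldType) (nu : discrete_valuation K).
Implicit Types c d e : K.

Lemma nu_ge0 n : 0 \in nu_ge nu n.
Proof. by rewrite inE eqxx. Qed.

Lemma nu_geN n c : c \in nu_ge nu n -> - c \in nu_ge nu n.
Proof. by rewrite -sub0r => cn; apply: nu_geB => //; apply: nu_ge0. Qed.

Lemma nu_geD n c d :
  c \in nu_ge nu n -> d \in nu_ge nu n -> c + d \in nu_ge nu n.
Proof.
by move=> cn dn; rewrite -[d]opprK; apply: nu_geB => //; apply: nu_geN.
Qed.

Lemma nu_ge_le m n c : m <= n -> c \in nu_ge nu n -> c \in nu_ge nu m.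
Proof.
rewrite !inE => mn /orP[->//|cn]; apply/orP; right.
exact: Order.POrderTheory.le_trans mn cn.
Qed.

Lemma nu_geM0 n c d :
  c \in val_ring nu -> d \in nu_ge nu n -> c * d \in nu_ge nu n.
Proof. by move=> cO dn; rewrite -[n]add0r; apply: nu_geM. Qed.

Lemma nu_ge_eq0 c : (forall n : nat, c \in nu_ge nu n) -> c = 0.
Proof.
move=> cn; apply/eqP; apply/negPn/negP => c0.
have := cn `|nu c|.+1%N; rewrite inE (negbTE c0) /=; lia.
Qed.

Lemma nuV c : c != 0 -> nu c^-1 = - nu c.
Proof.
move=> c0; have := nuM nu c0 (invr_neq0 c0); rewrite mulfV // nu1; lia.
Qed.

Definition nu_unit : pred K := fun c => (c != 0) && (nu c == 0).

Lemma nu_unitE c : nu_unit c = (c \in val_ring nu) && (c \notin nu_ge nu 1).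
Proof.
rewrite /nu_unit /val_ring !inE; case: (c == 0) => //=; lia.
Qed.

Lemma nu_unitV c : nu_unit c -> nu_unit c^-1.
Proof.
by case/andP=> c0 /eqP cn; rewrite /nu_unit invr_eq0 c0 nuV // cn oppr0.
Qed.

Lemma nu_unitM c d : nu_unit c -> nu_unit d -> nu_unit (c * d).
Proof.
case/andP=> c0 /eqP cn /andP[d0 /eqP dn].
by rewrite /nu_unit mulf_neq0 // nuM // cn dn addr0.
Qed.

Lemma nu_unitN c : nu_unit c -> nu_unit (- c).
Proof. by rewrite /nu_unit oppr_eq0 nuN. Qed.

Lemma nu_unit_sqr c : nu_unit (c ^+ 2) -> nu_unit c.
Proof.
rewrite /nu_unit expf_eq0 /= => /andP[c0]; rewrite c0 expr2 nuM //=; lia.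
Qed.

Lemma nu_unit_val_ring c : nu_unit c -> c \in val_ring nu.
Proof. by rewrite nu_unitE => /andP[]. Qed.

Lemma nu_unitP c : unit_of (fun c => c \in val_ring nu) c <-> nu_unit c.
Proof.
split=> [[cO [d [dO cd _]]]|cU].
  have [c0 d0] : c != 0 /\ d != 0.
    by apply/andP; rewrite -negb_or -mulf_eq0 cd oner_neq0.
  move: cO dO; rewrite /nu_unit /val_ring !inE c0 (negbTE c0) (negbTE d0) /=.
  have := nuM nu c0 d0; rewrite cd nu1; lia.
split; first exact: nu_unit_val_ring.
exists c^-1; have c0 : c != 0 by case/andP: cU.
by rewrite nu_unit_val_ring ?nu_unitV // mulfV // mulVf.
Qed.

Lemma nu_ge1_sqr c : c ^+ 2 \in nu_ge nu 1 -> c \in nu_ge nu 1.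
Proof.
rewrite !inE expf_eq0 /=; have [//|c0] := eqVneq c 0.
rewrite expr2 nuM //=; lia.
Qed.

(** The residue class of 2 vanishes exactly when 2 is in the maximal ideal. *)
Lemma nu_unit2 : 2%N \notin [pchar (residue_field nu)] -> nu_unit 2.
Proof.
move=> char2; rewrite nu_unitE -[2]/(1 + 1); apply/andP; split.
  by apply: nu_geD; rewrite inE nu1 Order.POrderTheory.lexx orbT.
apply: contra char2 => h; rewrite inE /=.
by rewrite /residue_field mulr2n !piE Quotient.equivE subr0.
Qed.

(** Hensel's lemma for X^2 - (1 + e): writing the root as 1 + v, the equation
becomes v = (e - v^2) / 2, whose right-hand side is a contraction of the
maximal ideal. *)
Lemma hensel_sqrt1 e : nu_complete nu -> nu_unit 2 -> e \in nu_ge nu 1 ->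
  exists2 c, c - 1 \in nu_ge nu 1 & c ^+ 2 = 1 + e.
Proof.
move=> complete two_unit e1.
have two_neq0 : (2 : K) != 0 by case/andP: two_unit.
have half n c : c \in nu_ge nu n -> c / 2 \in nu_ge nu n.
  rewrite mulrC; apply: nu_geM0.
  exact: nu_unit_val_ring (nu_unitV two_unit).
pose v n := iter n (fun x => (e - x ^+ 2) / 2) 0.
(* [step] and [tail] say that v is Cauchy: v n agrees with all later terms
   modulo the power n + 1 of the maximal ideal. *)
have vS n : v n.+1 = (e - v n ^+ 2) / 2 by [].
have v1 n : v n \in nu_ge nu 1.
  elim: n => [|n IHn]; first exact: nu_ge0.
  rewrite vS; apply: half; apply: nu_geB => //.
  apply: (@nu_ge_le 1 (1 + 1)) => //; exact: nu_geM.
have step n : v n.+1 - v n \in nu_ge nu n.+1.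
  elim: n => [|n IHn]; first by rewrite subr0; apply: v1.
  have -> : v n.+2 - v n.+1 = - ((v n.+1 - v n) * ((v n.+1 + v n) / 2)).
    by rewrite (vS n.+1) {2}(vS n); field; rewrite two_neq0.
  have -> : n.+2%:Z = n.+1%:Z + 1 by lia.
  apply: nu_geN; apply: nu_geM => //.
  by apply: half; apply: nu_geD.
have tail N k : v (N + k)%N - v N \in nu_ge nu N.+1.
  elim: k => [|k IHk]; first by rewrite addn0 subrr nu_ge0.
  rewrite addnS -(subrK (v (N + k)%N) (v (N + k).+1)) -addrA.
  apply: nu_geD => //; apply: nu_ge_le (step _); lia.
have [l vl] : exists l, nu_converges nu v l.
  apply: complete => n; exists `|n|%N => i j Ni Nj.
  rewrite -(subrK (v `|n|%N) (v i)) -addrA; apply: nu_geD.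
    rewrite -(subnKC Ni); apply: nu_ge_le (tail _ _); lia.
  rewrite -opprB; apply: nu_geN.
  rewrite -(subnKC Nj); apply: nu_ge_le (tail _ _); lia.
have l1 : l \in nu_ge nu 1.
  have [N /(_ N (leqnn N)) vNl] := vl 1.
  by rewrite -(subKr (v N) l); apply: nu_geB.
exists (1 + l); first by rewrite addrC addKr.
apply/eqP; rewrite -subr_eq0; apply/eqP/nu_ge_eq0 => n.
have [N vN] := vl n.
have -> : (1 + l) ^+ 2 - (1 + e) =
    - ((v N - l) * (v N + l)) - (v N.+1 - l) * 2.
  rewrite vS; field; by rewrite two_neq0.
apply: nu_geB.
  apply: nu_geN; rewrite mulrC; apply: nu_geM0; last exact: vN.
  by apply: (@nu_ge_le 0 1) => //; apply: nu_geD.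
rewrite mulrC; apply: nu_geM0; first exact: nu_unit_val_ring.
by apply: vN; lia.
Qed.

End ValuationTheory.

(** * One-dimensional hermitian forms *)

Section OneDimensionalForms.
Set Implicit Arguments.
Unset Strict Implicit.
Variables (K : fieldType) (D : unitAlgType K).

Definition involution_first_kind (sigma : D -> D) : Prop :=
  [/\ {morph sigma : d e / d + e},
      forall d e, sigma (d * e) = sigma e * sigma d,
      involutive sigma & forall c, {morph sigma : d / c *: d}].

Variables (sigma : D -> D) (eps : K).
Hypothesis sigmaI : involution_first_kind sigma.

Lemma form1_hermitian u : sigma u = eps *: u ->
  eps_hermitian sigma eps (form1 sigma u).
Proof.
case: sigmaI => sD sM sK sZ su; rewrite /form1; split.
- by move=> d1 d2 e; rewrite sD !mulrDl.
- by move=> d e1 e2; rewrite mulrDr.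
- by move=> d e c c'; rewrite sM !mulrA.
- by move=> d e; rewrite !sM sK su -scalerAl -scalerAr mulrA.
Qed.

(** The isometry is left multiplication by t. *)
Lemma isometric_form1 u w t : sigma u = eps *: u -> sigma w = eps *: w ->
  t \is a GRing.unit -> sigma t * w * t = u ->
  isometric sigma eps (form1 sigma u) (form1 sigma w).
Proof.
move=> su sw tU tu; case: (sigmaI) => _ sM _ _.
split; [exact: form1_hermitian | exact: form1_hermitian |].
exists (fun d => t * d); split.
- by exists (fun d => t^-1 * d) => d; [apply: mulKr | apply: mulVKr].
- exact: mulrDr.
- by move=> d c; rewrite mulrA.
- by move=> d e; rewrite /form1 sM -tu !mulrA.
Qed.

(** From w g = u and the symmetry of u and w one gets sigma(g) w = w g, and the
same relation for t, which is a polynomial in g; so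
sigma(t) w t = w t^2 = w g = u. *)
Lemma isometric_sqrt u w g t c s : eps != 0 ->
  sigma u = eps *: u -> sigma w = eps *: w -> w * g = u ->
  t = s *: (g + c%:A) -> t ^+ 2 = g -> g \is a GRing.unit ->
  isometric sigma eps (form1 sigma u) (form1 sigma w).
Proof.
move=> eps0 su sw wg tE t2 gU; case: (sigmaI) => _ sM sK sZ.
apply: (@isometric_form1 u w t) => //.
  by move: gU; rewrite -t2 expr2 unitrM_comm // andbb.
have s1 : sigma 1 = 1 by have := sM (sigma 1) 1; rewrite mulr1 sK mulr1.
have sg : sigma g * w = w * g.
  apply: (scalerI eps0); rewrite scalerAr -sw -sM wg; exact: su.
have -> : sigma t * w = w * t.
  case: sigmaI => sD _ _ _.
  rewrite tE sZ sD sZ s1 -scalerAl mulrDl sg -scalerAl mul1r.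
  by rewrite -scalerAr mulrDr -scalerAr mulr1.
by rewrite -mulrA -expr2 t2.
Qed.

End OneDimensionalForms.

(** * Quaternion algebras and their involutions *)

Section Quaternions.
Set Implicit Arguments.
Unset Strict Implicit.
Variables (K : fieldType) (a b : K).
Local Notation D := (quat a b).
Local Notation Q := (@Quat K a b).

Lemma quat_basisE p q r s :
  p%:A + q *: quat_x + r *: quat_y + s *: quat_z = Q p q r s.
Proof. by congr Quat => /=; ring. Qed.

Lemma quat_yzE r s : r *: quat_y + s *: quat_z = Q 0 0 r s.
Proof. by congr Quat => /=; ring. Qed.

Lemma quat_1xE p q : p%:A + q *: quat_x = Q p q 0 0.
Proof. by congr Quat => /=; ring. Qed.

Lemma quat_unitE (d : D) : (d \is a GRing.unit) = (nrd d != 0).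
Proof. by []. Qed.

Lemma nrd1 : nrd (1 : D) = 1.
Proof. by rewrite /nrd /=; ring. Qed.

Lemma nrd_conj (d : D) : nrd (quat_conj d) = nrd d.
Proof. by rewrite /nrd /=; ring. Qed.

Lemma nrdZ c (d : D) : nrd (c *: d) = c ^+ 2 * nrd d.
Proof. by rewrite /nrd /=; ring. Qed.

(** Cayley-Hamilton: 2 * qre d is the reduced trace. *)
Lemma quat_sqr (d : D) : d ^+ 2 = (2 * qre d) *: d - (nrd d)%:A.
Proof. by case: d => ????; rewrite /nrd; congr Quat => /=; ring. Qed.

(** With trace T and norm c^2, the identity d^2 = T d - c^2 gives
(d + c)^2 = (T + 2 c) d, so that d + c is a square root of d up to a scalar. *)
Lemma quat_sqrt (d : D) c : nrd d = c ^+ 2 ->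
  (d + c%:A) ^+ 2 = (2 * (qre d + c)) *: d.
Proof.
move=> dc; rewrite quat_sqr.
have -> : nrd (d + c%:A) = 2 * (qre d + c) * c.
  have -> : nrd (d + c%:A) = nrd d + 2 * qre d * c + c ^+ 2.
    by rewrite /nrd /=; ring.
  by rewrite dc; ring.
have -> : qre (d + c%:A) = qre d + c by rewrite /=; ring.
by rewrite scalerDr scalerA addrK.
Qed.

Lemma quat_conj_involution : involution_first_kind (@quat_conj K a b).
Proof.
split; first by move=> [????] [????]; congr Quat => /=; ring.
- by move=> [????] [????]; congr Quat => /=; ring.
- by move=> [????]; congr Quat => /=; ring.
- by move=> c [????]; congr Quat => /=; ring.
Qed.

(** An explicit form, from which sigma is seen to act diagonally on the basis
1, x, y, z. *)
Lemma quat_conj_by_xE d : a != 0 ->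
  quat_conj_by quat_x d = Q (qre d) (- qix d) (qiy d) (qiz d).
Proof.
move=> a0; have xU : (quat_x : D) \is a GRing.unit.
  rewrite quat_unitE /nrd /= !expr0n expr1n /= !mulr0 mulr1.
  by rewrite sub0r subr0 addr0 oppr_eq0.
apply: (canLR (mulrK xU)).
by case: d => ????; congr Quat => /=; ring.
Qed.

Lemma quat_conj_by_yE d : b != 0 ->
  quat_conj_by quat_y d = Q (qre d) (qix d) (- qiy d) (qiz d).
Proof.
move=> b0; have yU : (quat_y : D) \is a GRing.unit.
  rewrite quat_unitE /nrd /= !expr0n expr1n /= !mulr0 mulr1.
  by rewrite subr0 sub0r addr0 oppr_eq0.
apply: (canLR (mulrK yU)).
by case: d => ????; congr Quat => /=; ring.
Qed.

Lemma quat_conj_by_x_involution : a != 0 ->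
  involution_first_kind (@quat_conj_by K a b quat_x).
Proof.
move=> a0; have E := quat_conj_by_xE _ a0.
split; first by move=> [????] [????]; rewrite !E; congr Quat => /=; ring.
- by move=> [????] [????]; rewrite !E; congr Quat => /=; ring.
- by move=> [????]; rewrite !E; congr Quat => /=; ring.
- by move=> c [????]; rewrite !E; congr Quat => /=; ring.
Qed.

Lemma quat_conj_by_y_involution : b != 0 ->
  involution_first_kind (@quat_conj_by K a b quat_y).
Proof.
move=> b0; have E := quat_conj_by_yE _ b0.
split; first by move=> [????] [????]; rewrite !E; congr Quat => /=; ring.
- by move=> [????] [????]; rewrite !E; congr Quat => /=; ring.
- by move=> [????]; rewrite !E; congr Quat => /=; ring.
- by move=> c [????]; rewrite !E; congr Quat => /=; ring.
Qed.

End Quaternions.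

(** * Ramified elements over a complete field *)

Section CompleteField.
Set Implicit Arguments.
Unset Strict Implicit.
Variables (K : fieldType) (nu : discrete_valuation K).
Hypotheses (complete : nu_complete nu) (two_unit : nu_unit nu 2).
Variables (a pi : K).
Local Notation D := (quat a pi).
Local Notation Q := (@Quat K a pi).

(** The element g has trace 2 and norm close to 1, as if it were close to 1
itself: both square roots needed to extract a square root of g from
[quat_sqrt] then exist by Hensel's lemma. *)
Lemma isometric_near (sigma : D -> D) eps (u w g : D) :
  involution_first_kind sigma -> eps != 0 ->
  sigma u = eps *: u -> sigma w = eps *: w -> w * g = u ->
  qre g = 1 -> nrd g - 1 \in nu_ge nu 1 ->
  isometric sigma eps (form1 sigma u) (form1 sigma w).
Proof.
move=> sI eps0 su sw wg g1 ng1.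
have two0 : (2 : K) != 0 by case/andP: two_unit.
have near1 e : e - 1 \in nu_ge nu 1 -> e != 0.
  apply: contraTneq => ->; rewrite sub0r inE oppr_eq0 oner_eq0 nuN nu1 /=; lia.
have [c c1] := hensel_sqrt1 complete two_unit ng1; rewrite addrC subrK => c2.
have h1 : (c - 1) / 2 \in nu_ge nu 1.
  by rewrite mulrC; apply: nu_geM0 c1; apply/nu_unit_val_ring/nu_unitV.
have [s s1 s2] := hensel_sqrt1 complete two_unit h1.
have s0 := near1 _ s1.
(* (2 s)^2 = 4 (1 + (c - 1) / 2) = 2 (1 + c) is the scalar of [quat_sqrt]. *)
apply: (@isometric_sqrt K D sigma eps sI u w g
  ((2 * s)^-1 *: (g + c%:A)) c (2 * s)^-1) => //; last first.
  by rewrite quat_unitE near1.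
have E : (2 * s) ^+ 2 = 2 * (1 + c) by rewrite exprMn s2; field; rewrite two0.
have c10 : 2 * (1 + c) != 0 by rewrite -E expf_neq0 // mulf_neq0.
rewrite exprZn exprVn E.
by rewrite (quat_sqrt (esym c2)) g1 scalerA mulVf // scale1r.
Qed.

(** If q were a unit, then a would be a square modulo the maximal ideal, hence a
square by Hensel's lemma, and D would have a nonzero element of norm 0. *)
Lemma nonsquare_norm p q : division_algebra D -> nu_unit nu a ->
  p \in val_ring nu -> q \in val_ring nu ->
  p ^+ 2 - a * q ^+ 2 \in nu_ge nu 1 ->
  p \in nu_ge nu 1 /\ q \in nu_ge nu 1.
Proof.
move=> Ddiv aU pO qO N1.
have [q1|q1] := boolP (q \in nu_ge nu 1).
  split=> //; apply: nu_ge1_sqr; rewrite -(subrK (a * q ^+ 2) (p ^+ 2)).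
  apply: nu_geD => //; apply: nu_geM0; first exact: nu_unit_val_ring.
  by rewrite expr2; apply: nu_geM0.
have qU : nu_unit nu q by rewrite nu_unitE qO.
have q0 : q != 0 by case/andP: qU.
have a0 : a != 0 by case/andP: aU.
have qVO := nu_unit_val_ring (nu_unitV qU).
have pU : nu_unit nu p.
  rewrite nu_unitE pO; apply: contraL aU => p1.
  rewrite nu_unitE negb_and negbK; apply/orP; right.
  have -> : a = q^-1 * (q^-1 * (p * p - (p ^+ 2 - a * q ^+ 2))).
    by field; rewrite q0.
  by do 2!apply: nu_geM0 => //; apply: nu_geB => //; apply: nu_geM0.
have p0 : p != 0 by case/andP: pU.
have pVO := nu_unit_val_ring (nu_unitV pU).
(* The number (p / q)^2 c^2 is exactly a. *)
have e1 : - (p^-1 * (p^-1 * (p ^+ 2 - a * q ^+ 2))) \in nu_ge nu 1.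
  by apply: nu_geN; do 2!apply: nu_geM0 => //.
have [c _ c2] := hensel_sqrt1 complete two_unit e1.
have : Q (p * c / q) 1 0 0 \is a GRing.unit.
  by apply: Ddiv; apply/eqP => -[_ /eqP]; rewrite oner_eq0.
rewrite quat_unitE /nrd /= !expr0n expr1n /= !mulr0 subr0 addr0 mulr1.
rewrite !exprMn c2 exprVn => /eqP[]; field; by rewrite q0 p0.
Qed.

(** In nrd u = (p^2 - a q^2) - pi B, the first term is zero or has even valuation, so
the odd valuation 1 must come from pi B. *)
Lemma ramified_coef p q r s : division_algebra D -> nu_unit nu a ->
  pi != 0 -> nu pi = 1 ->
  p \in val_ring nu -> q \in val_ring nu ->
  r \in val_ring nu -> s \in val_ring nu ->
  nrd (Q p q r s) != 0 -> nu (nrd (Q p q r s)) = 1 ->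
  [/\ p \in nu_ge nu 1, q \in nu_ge nu 1 & nu_unit nu (r ^+ 2 - a * s ^+ 2)].
Proof.
move=> Ddiv aU pi0 pi1 pO qO rO sO N0 N1.
have aO := nu_unit_val_ring aU.
set B := _ - _.
have NE : nrd (Q p q r s) = (p ^+ 2 - a * q ^+ 2) - pi * B.
  by rewrite /nrd /B /=; ring.
have BO : B \in val_ring nu.
  apply: nu_geB; first by rewrite expr2; apply: nu_geM0.
  by rewrite expr2; do 2!apply: nu_geM0 => //.
have piI : pi \in nu_ge nu 1 by rewrite inE pi1 Order.POrderTheory.lexx orbT.
have NI : nrd (Q p q r s) \in nu_ge nu 1.
  by rewrite inE N1 Order.POrderTheory.lexx orbT.
have [p1 q1] : p \in nu_ge nu 1 /\ q \in nu_ge nu 1.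
  apply: nonsquare_norm => //; rewrite -(subrK (pi * B) (p ^+ 2 - _)) -NE.
  by apply: nu_geD => //; rewrite mulrC; apply: nu_geM0.
split=> //; rewrite nu_unitE BO /=; apply/negP => B1.
have : nrd (Q p q r s) \in nu_ge nu (1 + 1).
  rewrite NE; apply: nu_geB; last exact: nu_geM.
  apply: nu_geB; first by rewrite expr2; apply: nu_geM.
  by apply: nu_geM0 => //; rewrite expr2; apply: nu_geM.
by rewrite inE (negbTE N0) N1.
Qed.

(** Here g = w^-1 u with w = r y + s z: the orthogonality of p + q x and w makes
the reduced trace of g equal to 2, and nrd g - 1 = (p^2 - a q^2) / nrd w, whose
numerator has valuation at least 2 and whose denominator has valuation 1. *)
Lemma ramified_isometric (sigma : D -> D) eps p q r s :
  pi != 0 -> nu pi = 1 -> nu_unit nu a ->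
  involution_first_kind sigma -> eps != 0 ->
  sigma (Q p q r s) = eps *: Q p q r s ->
  sigma (Q 0 0 r s) = eps *: Q 0 0 r s ->
  p \in nu_ge nu 1 -> q \in nu_ge nu 1 ->
  nu_unit nu (r ^+ 2 - a * s ^+ 2) ->
  isometric sigma eps (form1 sigma (Q p q r s)) (form1 sigma (Q 0 0 r s)).
Proof.
move=> pi0 pi1 aU sI eps0 su sw p1 q1 BU.
set u := Q p q r s in su *; set w := Q 0 0 r s in sw *.
have B0 : r ^+ 2 - a * s ^+ 2 != 0 by case/andP: BU.
have NE : nrd w = - (pi * (r ^+ 2 - a * s ^+ 2)) by rewrite /nrd /=; ring.
have N0 : nrd w != 0 by rewrite NE oppr_eq0 mulf_neq0.
apply: (@isometric_near sigma eps u w ((nrd w)^-1 *: (quat_conj w * u))) => //.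
- by rewrite -scalerAr mulrA quat_mul_conj mulr_algl scalerA mulVf // scale1r.
- by rewrite NE /u /w /=; field; rewrite -NE.
rewrite nrdZ nrdM nrd_conj.
have -> : (nrd w)^-1 ^+ 2 * (nrd w * nrd u) - 1 =
    - ((r ^+ 2 - a * s ^+ 2)^-1 * (pi^-1 * (p ^+ 2 - a * q ^+ 2))).
  by rewrite NE /nrd /=; field; rewrite -NE N0 B0 pi0.
apply: nu_geN; apply: nu_geM0; first exact/nu_unit_val_ring/nu_unitV.
apply: (@nu_geM _ nu (-1) (1 + 1)).
  by rewrite inE nuV // pi1 Order.POrderTheory.lexx orbT.
apply: nu_geB; first by rewrite expr2; apply: nu_geM.
apply: nu_geM0; first exact: nu_unit_val_ring.
by rewrite expr2; apply: nu_geM.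
Qed.

Lemma unit_val_ring_Kx r s : nu_unit nu (r ^+ 2 - a * s ^+ 2) ->
  unit_of (@val_ring_Kx K nu a pi) (r%:A + s *: quat_x).
Proof.
move=> BU; set d := _ + _.
have NE : nrd d = r ^+ 2 - a * s ^+ 2 by rewrite /d quat_1xE /nrd /=; ring.
have dU : d \is a GRing.unit by rewrite quat_unitE NE; case/andP: BU.
have dS : adjoin quat_x d.
  move=> S [S1 SZD SV] Sx; have S0 : 0 \in S.
    by have := SZD (-1) _ _ S1 S1; rewrite scaleN1r addNr.
  by apply: (SZD) => //; rewrite -[s *: _]addr0; apply: (SZD).
have dVS : adjoin quat_x d^-1.
  move=> S Sdiv Sx; have [S1 _ SV] := Sdiv.
  by rewrite -div1r; apply: SV => //; apply: dS.
have nuDd0 e : nu_unit nu (nrd e) -> 0 <= nuD_quat nu e.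
  by case/andP=> _ /eqP e0; rewrite /nuD_quat e0 mul0r.
have nV : nrd d * nrd d^-1 = 1 by rewrite -nrdM divrr // nrd1.
have N0 : nrd d != 0 by rewrite -quat_unitE.
split; first by split=> //; right; apply: nuDd0; rewrite NE.
exists d^-1; rewrite divrr // mulVr //; split=> //.
split=> //; right; apply: nuDd0.
by rewrite -[nrd _](mulKf N0) nV mulr1 NE; apply: nu_unitV.
Qed.

End CompleteField.
(** * The classification *)

Theorem mainTheorem5 (K : fieldType) (nu : discrete_valuation K)
  (nu_compl : nu_complete nu)
  (char_res : 2%N \notin [pchar (residue_field nu)])
  (pi a : K)
  (pi_unif : pi != 0 /\ nu pi = 1)
  (a_unit : unit_of (fun c => c \in val_ring nu) a)
  (D_div : division_algebra (quat a pi))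
  (sigma : quat a pi -> quat a pi)
  (sigmaP : [\/ sigma = @quat_conj K a pi,
                sigma = quat_conj_by quat_x
              | sigma = quat_conj_by quat_y])
  (eps : K) (epsP : eps = 1 \/ eps = -1)
  (delta alpha beta gamma : K)
  (deltaO : delta \in val_ring nu) (alphaO : alpha \in val_ring nu)
  (betaO : beta \in val_ring nu) (gammaO : gamma \in val_ring nu)
  (u : quat a pi)
  (uE : u = delta%:A + alpha *: quat_x + beta *: quat_y + gamma *: quat_z)
  (u_sym : sigma u = eps *: u)
  (u_ram : u != 0 /\ nuD_quat nu u = 1 / 2) :
  [/\ sigma = @quat_conj K a pi ->
        [/\ eps = -1,
            isometric sigma eps (form1 sigma u)
              (form1 sigma (beta *: quat_y + gamma *: quat_z))
          & unit_of (@val_ring_Kx K nu a pi) (beta%:A + gamma *: quat_x)],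
      sigma = quat_conj_by quat_x ->
        [/\ eps = 1,
            isometric sigma eps (form1 sigma u)
              (form1 sigma (beta *: quat_y + gamma *: quat_z))
          & unit_of (@val_ring_Kx K nu a pi) (beta%:A + gamma *: quat_x)],
      sigma = quat_conj_by quat_y /\ eps = 1 ->
        isometric sigma eps (form1 sigma u) (form1 sigma (gamma *: quat_z))
        /\ unit_of (fun c => c \in val_ring nu) gamma
    & sigma = quat_conj_by quat_y /\ eps = -1 ->
        isometric sigma eps (form1 sigma u) (form1 sigma (beta *: quat_y))
        /\ unit_of (fun c => c \in val_ring nu) beta].
Proof.
have [pi0 pi1] := pi_unif; have [u0 nuDu] := u_ram.
have two_unit := nu_unit2 char_res.
have two0 : (2 : K) != 0 by case/andP: two_unit.
have aU : nu_unit nu a by apply/nu_unitP.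
have a0 : a != 0 by case/andP: aU.
have eps0 : eps != 0 by case: epsP => ->; rewrite ?oppr_eq0 oner_eq0.
have eqN0 (c : K) : - c = c -> c = 0.
  move=> cE; apply/eqP; rewrite -(mulrI_eq0 _ (mulfI two0)).
  by rewrite mulr_natl mulr2n -{1}cE addNr.
have nrd_u0 : nrd u != 0 by apply: D_div.
have nrd_u1 : nu (nrd u) = 1.
  apply: (@intr_inj rat); apply: (@mulIf _ (2^-1 : rat)) => //.
rewrite quat_basisE in uE.
rewrite quat_yzE; rewrite uE in nrd_u0 nrd_u1 u_sym *.
have [delta1 alpha1 BU] := ramified_coef nu_compl two_unit D_div aU pi0 pi1
  deltaO alphaO betaO gammaO nrd_u0 nrd_u1.
have not_both0 : ~ (beta = 0 /\ gamma = 0).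
  move=> [b0 c0]; move: BU => /andP[/eqP[]]; rewrite b0 c0; ring.
have KxU := unit_val_ring_Kx pi BU.
have iso sI sw := ramified_isometric nu_compl two_unit pi0 pi1 aU sI eps0
  u_sym sw delta1 alpha1 BU.
split.
- move=> sE; rewrite sE in u_sym iso *.
  have epsE : eps = -1.
    case: epsP => // eps1; case: not_both0; rewrite eps1 scale1r in u_sym.
    by case: u_sym => _ /eqN0-> /eqN0->.
  split=> //; apply: iso; first exact: quat_conj_involution.
  by rewrite epsE; congr Quat => /=; ring.
- move=> sE; rewrite sE in u_sym iso *; rewrite quat_conj_by_xE // in u_sym.
  have epsE : eps = 1.
    case: epsP => // eps1; case: not_both0; rewrite eps1 scaleN1r in u_sym.
    by case: u_sym => _ /esym/eqN0-> /esym/eqN0->.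
  split=> //; apply: iso; first exact: quat_conj_by_x_involution.
  by rewrite quat_conj_by_xE // epsE; congr Quat => /=; ring.
- move=> [sE epsE]; rewrite sE epsE in u_sym iso *.
  rewrite quat_conj_by_yE // scale1r in u_sym.
  have beta0 : beta = 0 by case: u_sym => /eqN0.
  rewrite beta0 in BU iso *.
  have -> : gamma *: quat_z = Quat 0 0 0 gamma :> quat a pi.
    by congr Quat => /=; ring.
  split.
    apply: iso; first exact: quat_conj_by_y_involution.
    by rewrite quat_conj_by_yE //; congr Quat => /=; ring.
  apply/nu_unitP; apply: nu_unit_sqr.
  have -> : gamma ^+ 2 = - (a^-1 * (0 ^+ 2 - a * gamma ^+ 2)).
    by field; rewrite a0.
  by apply: nu_unitN; apply: nu_unitM => //; apply: nu_unitV.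
- move=> [sE epsE]; rewrite sE epsE in u_sym iso *.
  rewrite quat_conj_by_yE // scaleN1r in u_sym.
  have gamma0 : gamma = 0 by case: u_sym => _ _ /esym/eqN0.
  rewrite gamma0 in BU iso *.
  have -> : beta *: quat_y = Quat 0 0 beta 0 :> quat a pi.
    by congr Quat => /=; ring.
  split.
    apply: iso; first exact: quat_conj_by_y_involution.
    by rewrite quat_conj_by_yE //; congr Quat => /=; ring.
  apply/nu_unitP; apply: nu_unit_sqr.
  by move: BU; rewrite expr0n mulr0 subr0.
Qed.
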